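(* Let $G$ be a connected simple graph on $n\ge 3$ vertices, and let $\Phi=\{\phi_i\}_{i\in[n]}$ be a $G(n,n-1)$-frame for $\mathbb{C}^{n-1}$. Then the canonical dual frame of $\Phi$ is the unique spectrally optimal dual frame of $\Phi$ for $2$-erasures, and $\rho^{(2)}_\Phi=1$.
   Context: Write $[n]=\{1,\dots,n\}$; inner products on $\mathbb{C}^d$ are standard and linear in the first argument. A finite sequence $\Phi=\{\phi_i\}_{i\in[n]}$ in $\mathbb{C}^d$ is a frame for $\mathbb{C}^d$ if there are constants $0<A\le B$ with $A\|f\|^2\le\sum_{i\in[n]}|\langle f,\phi_i\rangle|^2\le B\|f\|^2$ for all $f\in\mathbb{C}^d$. Its frame operator is $S_\Phi f=\sum_{i\in[n]}\langle f,\phi_i\rangle\phi_i$ (invertible). A frame $\Psi=\{\psi_i\}_{i\in[n]}$ of $\mathbb{C}^d$ is a dual frame of $\Phi$ if $f=\sum_{i\in[n]}\langle f,\phi_i\rangle\psi_i=\sum_{i\in[n]}\langle f,\psi_i\rangle\phi_i$ for all $f\in\mathbb{C}^d$; $D_\Phi$ denotes the set of dual frames of $\Phi$. The canonical dual frame of $\Phi$ is $S_\Phi^{-1}\Phi:=\{S_\Phi^{-1}\phi_i\}_{i\in[n]}\in D_\Phi$. Spectral optimality: for $\Psi\in D_\Phi$ and $\Lambda\subset[n]$, the error operator is $E_{\Phi,\Psi,\Lambda}(f)=\sum_{i\in\Lambda}\langle f,\phi_i\rangle\psi_i$ on $\mathbb{C}^d$, and for $1\le r<n$, $\rho^{(r)}_{\Phi,\Psi}:=\max\{\rho(E_{\Phi,\Psi,\Lambda}):\Lambda\subset[n],\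 |\Lambda|=r\}$, where $\rho(\cdot)$ is the spectral radius. Put $\rho^{(r)}_\Phi:=\min\{\rho^{(r)}_{\Phi,\widetilde\Psi}:\widetilde\Psi\in D_\Phi\}$. $\Psi\in D_\Phi$ is a spectrally optimal dual frame of $\Phi$ for $1$-erasure if $\rho^{(1)}_{\Phi,\Psi}=\rho^{(1)}_\Phi$. $\Psi$ is a spectrally optimal dual frame of $\Phi$ for $2$-erasures if it is a spectrally optimal dual frame for $1$-erasure and $\rho^{(2)}_{\Phi,\Psi}=\rho^{(2)}_\Phi$ (the minimum being over all of $D_\Phi$). Graph frames: for a simple graph $G$ with vertices $v_1,\dots,v_n$, the Laplacian matrix is $L(G)=D(G)-A(G)$ (degree matrix minus adjacency matrix). A frame $\Phi=\{\phi_i\}_{i\in[n]}$ for $\mathbb{C}^k$ is a $G(n,k)$-frame (frame generated by $G$) if its Gramian matrix $\mathcal{G}_\Phi=[\langle\phi_j,\phi_i\rangle]_{i,j\in[n]}$ equals $L(G)$. *)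

(* Defs.v *)
From mathcomp Require Import all_boot all_order all_algebra.
From mathcomp Require Import classical_sets reals.
From mathcomp Require Import complex.

Set Implicit Arguments.
Unset Strict Implicit.
Unset Printing Implicit Defensive.

Import Order.TTheory GRing.Theory Num.Theory.

Local Open Scope ring_scope.
Local Open Scope complex_scope.
Local Open Scope classical_set_scope.

Section Frames.
Variables (R : realType) (d n : nat).

(* C^d is 'rV[R[i]]_d, and dotmx u v = \sum_j u 0 j * (v 0 j)^* is linear in
   its first argument. *)
Implicit Types (Phi Psi : 'I_n -> 'rV[R[i]]_d) (f : 'rV[R[i]]_d).
Implicit Types (L : {set 'I_n}) (r : nat).

Definition is_frame Phi : Prop :=
  exists A B : R, [/\ 0 < A, A <= B &
    forall f, A%:C * dotmx f f <= \sum_(i < n) `|dotmx f (Phi i)| ^+ 2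
              /\ \sum_(i < n) `|dotmx f (Phi i)| ^+ 2 <= B%:C * dotmx f f].

Definition frame_op Phi f : 'rV[R[i]]_d := \sum_(i < n) dotmx f (Phi i) *: Phi i.

Definition is_dual_frame Phi Psi : Prop :=
  is_frame Psi /\
  forall f, f = \sum_(i < n) dotmx f (Phi i) *: Psi i
            /\ f = \sum_(i < n) dotmx f (Psi i) *: Phi i.

(* Matrices act on row vectors from the right: f *m lin1_mx T = T f for a linear
   map T, and the composite of T with its inverse is a product with invmx. *)
Definition canonical_dual Phi : 'I_n -> 'rV[R[i]]_d :=
  fun i => Phi i *m invmx (lin1_mx (frame_op Phi)).

Definition error_op Phi Psi L f : 'rV[R[i]]_d :=
  \sum_(i in L) dotmx f (Phi i) *: Psi i.

(* The order-theoretic norm `|a| of R[i] takes values in R[i]; normc a is the same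
   modulus as an element of R. *)
Definition spectral_radius (M : 'M[R[i]]_d) : R :=
  sup [set Normc.normc a | a in [set a | eigenvalue M a]].

(* Spectral radii are nonnegative, so the unit 0 does not affect the maximum when
   some L has cardinality r. *)
Definition rho Phi Psi r : R :=
  \big[Num.max/0]_(L : {set 'I_n} | #|L| == r)
    spectral_radius (lin1_mx (error_op Phi Psi L)).

Definition is_min (A : set R) (m : R) : Prop := A m /\ lbound A m.

(* m is the minimum of the r-erasure spectral error over all dual frames of Phi;
   in particular the minimum is attained. *)
Definition is_min_rho Phi r (m : R) : Prop :=
  is_min [set rho Phi Psi r | Psi in [set Psi | is_dual_frame Phi Psi]] m.

Definition spectrally_optimal1 Phi Psi : Prop :=
  is_dual_frame Phi Psi /\ is_min_rho Phi 1 (rho Phi Psi 1).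

Definition spectrally_optimal2 Phi Psi : Prop :=
  spectrally_optimal1 Phi Psi /\ is_min_rho Phi 2 (rho Phi Psi 2).

(* A simple graph on n vertices is a symmetric irreflexive e : rel 'I_n. *)
Definition adjacency_mx (e : rel 'I_n) : 'M[R[i]]_n := \matrix_(i, j) (e i j)%:R.

Definition degree_mx (e : rel 'I_n) : 'M[R[i]]_n :=
  diag_mx (\row_i #|[pred j | e i j]|%:R).

Definition laplacian_mx (e : rel 'I_n) : 'M[R[i]]_n := degree_mx e - adjacency_mx e.

Definition gramian_mx Phi : 'M[R[i]]_n := \matrix_(i, j) dotmx (Phi j) (Phi i).

Definition is_graph_frame (e : rel 'I_n) Phi : Prop :=
  is_frame Phi /\ gramian_mx Phi = laplacian_mx e.

Lemma mul_error_op Phi Psi L f :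
  f *m lin1_mx (error_op Phi Psi L) = error_op Phi Psi L f.
Proof.
apply/rowP => k; rewrite mxE /error_op summxE.
under eq_bigr => j _ do rewrite mxE summxE mulr_sumr.
rewrite exchange_big /=; apply: eq_bigr => i _; rewrite !mxE !dotmxE !mxE.
under eq_bigr => j _ do rewrite !mxE dotmxE -rowE !mxE mulrA.
by rewrite -mulr_suml; congr (_ * _); apply: eq_bigr => j _; rewrite !mxE.
Qed.

Lemma mul_frame_op Phi f : f *m lin1_mx (frame_op Phi) = frame_op Phi f.
Proof.
have E g : frame_op Phi g = error_op Phi Phi finset.setT g.
  by apply: eq_bigl => i; rewrite finset.in_setT.
rewrite E -mul_error_op; congr (_ *m _).
by apply/matrixP => i j; rewrite !mxE E.
Qed.

End Frames.

(* Main.v *)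
(** Since [L(G)] kills the all-ones vector, the [phi_i] sum to zero; as they
    span a space of dimension [n - 1], this is their only linear relation.
    Hence every dual frame satisfies [<psi_i, phi_j> = delta_ij - b_j] for some
    [b] with [\sum_j b_j = 1], the canonical one having [b_j = 1/n] because its
    cross Gramian is Hermitian.  The error operator of [{i}] has spectral radius
    [|1 - b_i|]; these numbers [1 - b_i] sum to [n - 1], so the largest modulus
    is at least [1 - 1/n], with equality only if every [b_i] is [1/n].  The
    error operator of [{i, j}] fixes [psi_i - psi_j], so its spectral radius is
    at least [1]; for the canonical dual its other eigenvalues are [1 - 2/n] and
    possibly [0]. *)

Require Import Defs.
From mathcomp Require Import all_boot all_order all_algebra.
From mathcomp Require Import classical_sets boolp reals complex ring lra.

Set Implicit Arguments.
Unset Strict Implicit.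
Unset Printing Implicit Defensive.

Import Order.TTheory GRing.Theory Num.Theory.
Local Open Scope ring_scope.
Local Open Scope complex_scope.
Local Open Scope sesquilinear_scope.

Lemma trmxC_mul (C : numClosedFieldType) m n p
  (A : 'M[C]_(m, n)) (B : 'M[C]_(n, p)) : (A *m B)^t* = B^t* *m A^t*.
Proof. by rewrite trmx_mul map_mxM. Qed.

Lemma trmxC1 (C : numClosedFieldType) n : (1%:M : 'M[C]_n)^t* = 1%:M.
Proof. by rewrite trmx1 map_mx1. Qed.

(** * Complex moduli, and the equality case of the triangle inequality *)

Section ComplexModulus.
Variable R : realType.
Implicit Types (z : R[i]) (a : R).

Lemma normcE z : (Normc.normc z)%:C = `|z|.
Proof. by case: z. Qed.

Lemma normc_ge0 z : 0 <= Normc.normc z.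
Proof. by rewrite -ler0c normcE. Qed.

Lemma normc_le z a : (Normc.normc z <= a) = (`|z| <= a%:C).
Proof. by rewrite -lecR normcE. Qed.

Lemma normc_real a : Normc.normc a%:C = `|a|.
Proof. by rewrite /= expr0n addr0 sqrtr_sqr. Qed.

Lemma ge0_complexP z : 0 <= z -> exists2 a, 0 <= a & z = a%:C.
Proof.
move=> z0; exists (complex.Re z); last by rewrite RRe_real ?ger0_real.
by rewrite -ler0c RRe_real ?ger0_real.
Qed.

Lemma sum_maximal_modulus (I : finType) (z : I -> R[i]) a :
  (forall i, `|z i| <= a%:C) -> \sum_i z i = a%:C *+ #|I| ->
  forall i, z i = a%:C.
Proof.
move=> za sz i; apply: (normC_sum_upper (P := predT) (G := fun=> a%:C)) => //.
by rewrite sz sumr_const.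
Qed.

End ComplexModulus.

(** * Bounds on the spectral radius *)

Section SpectralRadius.
Variables (R : realType) (d : nat).
Implicit Types (M : 'M[R[i]]_d) (a : R[i]).

Lemma spectral_radius_le M (c : R) : 0 <= c ->
  (forall a, eigenvalue M a -> Normc.normc a <= c) -> spectral_radius M <= c.
Proof.
move=> c0 Mc; rewrite /spectral_radius; set A := [set _ | _ in _]%classic.
(* The spectrum is empty when [d = 0]; [sup] is then 0, which [0 <= c] covers. *)
have [/eqP ->|/set0P A0] := boolP (A == set0); first by rewrite sup0.
by apply: ge_sup => // _ [a /= Ma <-]; exact: Mc.
Qed.

(** Eigenvalues are roots of [char_poly M], so the sum of the moduli of its roots bounds each of
    them; without a bound, [sup] would carry no information. *)
Lemma has_ubound_spectrum M :
  has_ubound [set Normc.normc a | a in [set a | eigenvalue M a]]%classic.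
Proof.
have [r Mr] := closed_field_poly_normal (char_poly M).
exists (\sum_(z <- r) Normc.normc z) => _ [a /= Ma <-].
have ar : a \in r.
  move: Ma; rewrite eigenvalue_root_char Mr rootZ ?root_prod_XsubC //.
  by rewrite lead_coef_eq0 monic_neq0 ?char_poly_monic.
by rewrite (big_rem a ar) /= lerDl sumr_ge0 // => z _; exact: normc_ge0.
Qed.

Lemma le_spectral_radius M a :
  eigenvalue M a -> Normc.normc a <= spectral_radius M.
Proof.
by move=> Ma; apply: ub_le_sup; [exact: has_ubound_spectrum | exists a].
Qed.

Lemma spectral_radius_ge0 M : 0 <= spectral_radius M.
Proof.
have [[a Ma]|noeig] := pselect (exists a, eigenvalue M a).
  exact: le_trans (normc_ge0 a) (le_spectral_radius Ma).
rewrite /spectral_radius [X in sup X](_ : _ = set0) ?sup0 //.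
by rewrite -subset0 => _ [a /= Ma _]; apply: noeig; exists a.
Qed.

End SpectralRadius.

(** * Frames and their duals as matrices *)

Section FrameMatrix.
Variables (R : realType) (d n : nat).
Implicit Types (Phi Psi : 'I_n -> 'rV[R[i]]_d) (f : 'rV[R[i]]_d).

(** On row vectors, [frame_mx Phi] acts as synthesis and its conjugate transpose as analysis. *)
Definition frame_mx Phi : 'M[R[i]]_(n, d) := \matrix_i Phi i.

Lemma mul_frame_mx Phi (x : 'rV_n) :
  x *m frame_mx Phi = \sum_i x 0 i *: Phi i.
Proof. by rewrite mulmx_sum_row; apply: eq_bigr => i _; rewrite rowK. Qed.

Lemma mul_frame_mx_adj Phi f i : (f *m (frame_mx Phi)^t*) 0 i = dotmx f (Phi i).
Proof.
by rewrite dotmxE !mxE; apply: eq_bigr => j _; rewrite !mxE.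
Qed.

Lemma sum_dotmx_scale Phi Psi f :
  \sum_i dotmx f (Phi i) *: Psi i = f *m ((frame_mx Phi)^t* *m frame_mx Psi).
Proof.
rewrite mulmxA mul_frame_mx; apply: eq_bigr => i _.
by rewrite mul_frame_mx_adj.
Qed.

Lemma sum_norm_dotmx Phi f :
  \sum_i `|dotmx f (Phi i)| ^+ 2 =
  dotmx (f *m (frame_mx Phi)^t*) (f *m (frame_mx Phi)^t*).
Proof.
rewrite [RHS]dotmxE mxE; apply: eq_bigr => i _.
rewrite normCK -mul_frame_mx_adj.
by rewrite [X in _ = _ * X]mxE [X in _ = _ * Num.conj X]mxE.
Qed.

Lemma frame_mx_adj Phi Psi i j :
  (frame_mx Psi *m (frame_mx Phi)^t*) i j = dotmx (Psi i) (Phi j).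
Proof. by rewrite dotmxE !mxE; apply: eq_bigr => k _; rewrite !mxE. Qed.

Lemma dual_mxC {Phi Psi} : (frame_mx Phi)^t* *m frame_mx Psi = 1%:M ->
  (frame_mx Psi)^t* *m frame_mx Phi = 1%:M.
Proof.
by move=> /(congr1 (fun A => A^t*)); rewrite trmxC_mul trmxCK trmxC1.
Qed.

Lemma bessel Phi : exists2 B : R, 0 < B &
  forall f, \sum_i `|dotmx f (Phi i)| ^+ 2 <= B%:C * dotmx f f.
Proof.
have [|b b0 sb] := @ge0_complexP R (\sum_i dotmx (Phi i) (Phi i)).
  by rewrite sumr_ge0 // => i _; exact: dnorm_ge0.
(* Here [b] is the sum of the squared norms; adding 1 keeps the bound positive when all vectors
   vanish. *)
exists (b + 1) => [|f]; first by rewrite ltr_wpDl.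
apply: (@le_trans _ _ (b%:C * dotmx f f)).
  rewrite -sb mulr_suml; apply: ler_sum => i _.
  by rewrite mulrC (CauchySchwarz (dotmx (n:=d))).
by rewrite ler_wpM2r ?dnorm_ge0 // lecR lerDl.
Qed.

(** With [x], [y] the coefficients of [f] against [Psi], [Phi], duality gives [<f,f> = <x,y>].
    Cauchy-Schwarz and the Bessel bound [B] of [Phi] then yield the lower frame bound [B^-1]. *)
Lemma frame_of_dual_mx {Phi Psi} :
  (frame_mx Phi)^t* *m frame_mx Psi = 1%:M -> is_frame Psi.
Proof.
move=> PhiPsi.
have [B B0 PhiB] := bessel Phi; have [B' B'0 PsiB] := bessel Psi.
(* Adding [B^-1] to the Bessel bound [B'] ensures that the two constants are ordered. *)
exists B^-1, (B' + B^-1); split=> [||f]; first by rewrite invr_gt0.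
  by rewrite lerDr ltW.
split; last first.
  apply: le_trans (PsiB f) _.
  by rewrite ler_wpM2r ?dnorm_ge0 // lecR lerDl invr_ge0 ltW.
have [->|f0] := eqVneq f 0.
  by rewrite linear0l mulr0 sumr_ge0 // => i _; exact: exprn_ge0.
have ff0 : 0 < dotmx f f by exact: dotmx_is_dotmx.
set x := f *m (frame_mx Psi)^t*; set y := f *m (frame_mx Phi)^t*.
have ffE : dotmx f f = dotmx x y.
  rewrite !dotmxE /x /y trmxC_mul trmxCK !mulmxA -(mulmxA f).
  by rewrite (dual_mxC PhiPsi) mulmx1.
rewrite sum_norm_dotmx -/x -(ler_pM2r ff0) -mulrA -expr2.
rewrite -[X in X * _]/(real_complex R B^-1) fmorphV.
rewrite ler_pdivrMl; last by rewrite /= ltcR.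
apply: le_trans (_ : dotmx x x * dotmx y y <= _).
  rewrite -[X in X ^+ 2]ger0_norm ?dnorm_ge0 // {1}ffE.
  exact: CauchySchwarz.
rewrite mulrCA; apply: ler_wpM2l; first exact: dnorm_ge0.
by rewrite /y -sum_norm_dotmx.
Qed.

Lemma is_dual_frameP Phi Psi :
  is_dual_frame Phi Psi <-> (frame_mx Phi)^t* *m frame_mx Psi = 1%:M.
Proof.
split=> [[_ PhiPsi]|PhiPsi].
  apply/row_matrixP => i; rewrite !rowE mulmx1 -sum_dotmx_scale.
  by rewrite -(PhiPsi _).1.
split=> [|f]; first exact: frame_of_dual_mx PhiPsi.
by rewrite !sum_dotmx_scale PhiPsi (dual_mxC PhiPsi) mulmx1.
Qed.

Lemma frame_op_mx Phi :
  lin1_mx (frame_op Phi) = (frame_mx Phi)^t* *m frame_mx Phi.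
Proof.
by apply/row_matrixP => i; rewrite !rowE mul_frame_op -sum_dotmx_scale.
Qed.

Lemma frame_op_unit Phi : is_frame Phi -> lin1_mx (frame_op Phi) \in unitmx.
Proof.
move=> [A [? [A0 _ PhiA]]]; rewrite -row_free_unit -kermx_eq0.
apply/rowV0P => f /sub_kermxP; rewrite frame_op_mx => fS.
apply/eqP; apply: contraT => f0; have [+ _] := PhiA f.
have ff0 : 0 < dotmx f f by exact: dotmx_is_dotmx.
rewrite sum_norm_dotmx [X in _ <= X]dotmxE trmxC_mul trmxCK.
by rewrite mulmxA -(mulmxA f) fS mul0mx mxE => /le_gtF; rewrite mulr_gt0 // ltcR.
Qed.

Lemma canonical_dual_mx Phi :
  frame_mx (canonical_dual Phi) =
  frame_mx Phi *m invmx (lin1_mx (frame_op Phi)).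
Proof. by apply/row_matrixP => i; rewrite row_mul !rowK. Qed.

Lemma canonical_dual_is_dual Phi :
  is_frame Phi -> is_dual_frame Phi (canonical_dual Phi).
Proof.
move=> fPhi; apply/is_dual_frameP.
by rewrite canonical_dual_mx mulmxA -frame_op_mx mulmxV ?frame_op_unit.
Qed.

Lemma canonical_dual_herm Phi : is_frame Phi ->
  (frame_mx (canonical_dual Phi) *m (frame_mx Phi)^t*)^t* =
  frame_mx (canonical_dual Phi) *m (frame_mx Phi)^t*.
Proof.
move=> /frame_op_unit uS; rewrite canonical_dual_mx; set S := lin1_mx _ in uS *.
have Sh : S^t* = S by rewrite /S frame_op_mx trmxC_mul trmxCK.
by rewrite !trmxC_mul trmxCK trmx_inv map_invmx Sh mulmxA.
Qed.

End FrameMatrix.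

(** * Eigenvalues of error operators for one and two erasures *)

Section Erasures.
Variables (R : realType) (d n : nat).
Implicit Types (Phi Psi : 'I_n -> 'rV[R[i]]_d) (L : {set 'I_n}).

(** Pairing the eigenvector equation with each [Phi j] turns it into one for the cross Gramian, with
    [x i = <f, Phi i>]. If [x] vanished on [L], then [a *: f] would be 0. *)
Lemma error_op_eigenvalue Phi Psi L a :
  eigenvalue (lin1_mx (error_op Phi Psi L)) a -> a != 0 ->
  exists2 x : 'I_n -> R[i], exists2 i, i \in L & x i != 0 &
    forall j, a * x j = \sum_(i in L) x i * dotmx (Psi i) (Phi j).
Proof.
move=> /eigenvalueP [f]; rewrite mul_error_op => fa f0 a0.
exists (fun i => dotmx f (Phi i)) => [|j]; last first.
  rewrite -[LHS]linearZl_LR /= -fa linear_sumlz; apply: eq_bigr => i _.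
  by rewrite linearZl_LR.
have [/exists_inP [i iL xi]|] := boolP [exists i in L, dotmx f (Phi i) != 0].
  by exists i.
rewrite negb_exists_in => /forall_inP x0.
suff : a *: f == 0 by rewrite scaler_eq0 (negPf a0) (negPf f0).
rewrite -fa; apply/eqP/big1 => i /x0; rewrite negbK => /eqP ->.
by rewrite scale0r.
Qed.

Lemma le_rho1 Phi Psi i : Normc.normc (dotmx (Psi i) (Phi i)) <= rho Phi Psi 1.
Proof.
have := @le_bigmax_cond _ R {set 'I_n} 0 [set i] (fun L => #|L| == 1)
  (fun L => spectral_radius (lin1_mx (error_op Phi Psi L))).
rewrite cards1 => /(_ isT); apply: le_trans.
have [->|ii] := eqVneq (dotmx (Psi i) (Phi i)) 0.
  by rewrite Normc.normc0 spectral_radius_ge0.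
apply: le_spectral_radius; apply/eigenvalueP; exists (Psi i).
  by rewrite mul_error_op /error_op big_set1.
by apply: contra ii => /eqP ->; rewrite linear0l.
Qed.

Lemma rho1_le Phi Psi (c : R) :
  (forall i, Normc.normc (dotmx (Psi i) (Phi i)) <= c) -> 0 <= c ->
  rho Phi Psi 1 <= c.
Proof.
move=> Pc c0; apply: bigmax_le => // L /cards1P [i ->].
apply: spectral_radius_le => // a Ea.
have [->|a0] := eqVneq a 0; first by rewrite Normc.normc0.
have [x [j]] := error_op_eigenvalue Ea a0.
rewrite inE => /eqP -> xi /(_ i); rewrite big_set1 mulrC => /(mulfI xi) ->.
exact: Pc.
Qed.

Lemma rho2_ge1 Phi Psi (b : 'I_n -> R[i]) : (1 < n)%N ->
  (forall i j, dotmx (Psi i) (Phi j) = (i == j)%:R - b j) ->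
  1 <= rho Phi Psi 2.
Proof.
move=> n1 Pb; pose i := Ordinal (ltnW n1); pose j := Ordinal n1.
have ij : i != j by [].
have := @le_bigmax_cond _ R {set 'I_n} 0 [set i; j] (fun L => #|L| == 2)
  (fun L => spectral_radius (lin1_mx (error_op Phi Psi L))).
rewrite cards2 ij => /(_ isT); apply: le_trans.
rewrite -[leLHS](@Normc.normc1 R); apply: le_spectral_radius.
(* The terms [b i] and [b j] cancel in the difference, leaving coefficients 1 and -1. *)
have pi : dotmx (Psi i - Psi j) (Phi i) = 1.
  by rewrite linearBl /= !Pb eqxx eq_sym (negPf ij) /=; ring.
have pj : dotmx (Psi i - Psi j) (Phi j) = -1.
  by rewrite linearBl /= !Pb eqxx (negPf ij) /=; ring.
apply/eigenvalueP; exists (Psi i - Psi j).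
  rewrite mul_error_op /error_op big_setU1 ?inE // big_set1 pi pj.
  by rewrite scaleN1r !scale1r.
by apply/eqP => p0; move/eqP: pi; rewrite p0 linear0l eq_sym oner_eq0.
Qed.

Lemma rho2_le1 Phi Psi (c : R) : 0 <= c <= 1 ->
  (forall i j, dotmx (Psi i) (Phi j) = (i == j)%:R - c%:C) ->
  rho Phi Psi 2 <= 1.
Proof.
move=> /andP [c0 c1] Pc; apply: bigmax_le => // L /cards2P [i [j [ij ->]]].
apply: spectral_radius_le => // a Ea.
have [->|a0] := eqVneq a 0; first by rewrite Normc.normc0.
have [x [k kL xk] ax] := error_op_eigenvalue Ea a0.
have {}ax l :
    a * x l = x i * ((i == l)%:R - c%:C) + x j * ((j == l)%:R - c%:C).
  by rewrite ax big_setU1 ?inE // big_set1 !Pc.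
(* Subtracting the equations at [i] and [j] removes [c]: either [a = 1], or [x i = x j] and
   [a = 1 - 2c], which lies in [[-1, 1]]. *)
have xij : (a - 1) * (x i - x j) = 0.
  rewrite mulrBl mul1r mulrBr !ax !eqxx eq_sym (negPf ij) /=; ring.
move/eqP: xij; rewrite mulf_eq0 !subr_eq0 => /orP [/eqP ->|/eqP xij].
  by rewrite Normc.normc1.
have xi : x i != 0.
  by move: kL xk; rewrite !inE => /orP [] /eqP -> //; rewrite xij.
have -> : a = (1 - 2 * c)%:C.
  apply: (mulIf xi); rewrite ax -xij eqxx eq_sym (negPf ij).
  rewrite rmorphB rmorphM /= !rmorph1 rmorph_nat; ring.
rewrite normc_real ler_norml; apply/andP; split; lra.
Qed.

End Erasures.

(** * Duals of [d + 1] vectors in dimension [d] with sum zero *)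

Section SimplexFrames.
Variables (R : realType) (d : nat).
Implicit Types (Phi Psi : 'I_d.+1 -> 'rV[R[i]]_d).

Lemma dual_frame_gram Phi Psi : \sum_i Phi i = 0 -> is_dual_frame Phi Psi ->
  exists2 b : 'I_d.+1 -> R[i], \sum_j b j = 1 &
    forall i j, dotmx (Psi i) (Phi j) = (i == j)%:R - b j.
Proof.
move=> Phi0 /is_dual_frameP PhiPsi; set F := frame_mx Phi in PhiPsi *.
pose u : 'rV[R[i]]_d.+1 := const_mx 1.
have uF : u *m F = 0.
  rewrite mul_frame_mx -[RHS]Phi0.
  by apply: eq_bigr => i _; rewrite mxE scale1r.
have rF : \rank F = d.
  by apply/eqP/row_fullP; exists ((frame_mx Psi)^t*); exact: dual_mxC.
have u0 : u != 0.
  by apply/eqP => /matrixP/(_ 0 0)/eqP; rewrite !mxE oner_eq0.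
(* The left kernel of [F] has dimension [(d + 1) - d = 1] and contains [u], which is nonzero. *)
have keru : (kermx F <= u)%MS.
  have : (u <= kermx F)%MS by apply/sub_kermxP.
  move/mxrank_leqif_eq => [_].
  by rewrite mxrank_ker rF rank_rV u0 subSnn eqxx => /esym/andP[].
have /submxP [D DE] : (1%:M - F *m (frame_mx Psi)^t* <= u)%MS.
  apply: submx_trans keru; apply/sub_kermxP.
  by rewrite mulmxBl mul1mx -mulmxA (dual_mxC PhiPsi) mulmx1 subrr.
pose b j := (D j 0)^*.
have Pb i j : dotmx (Psi i) (Phi j) = (i == j)%:R - b j.
  rewrite (hermC (dotmx (n:=d))) expr0 mul1r /= -frame_mx_adj -/F /b.
  move: (F *m _) DE => G /matrixP/(_ j i).
  rewrite !mxE big_ord1 !mxE mulr1 => <-.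
  by rewrite rmorphB rmorph_nat eq_sym subKr.
exists b => //; apply/eqP; rewrite eq_sym -subr_eq0; apply/eqP.
(* Both sides compute the pairing of [Psi 0] with the zero vector [\sum_j Phi j]. *)
transitivity (dotmx (Psi 0) (\sum_j Phi j)); last by rewrite Phi0 linear0r.
rewrite linear_sumr /=; under [RHS]eq_bigr => j _ do rewrite Pb.
rewrite sumrB; congr (_ - _).
by rewrite (bigD1 0) //= big1 ?addr0 // => j /negPf; rewrite eq_sym => ->.
Qed.

Lemma canonical_dual_gram Phi : \sum_i Phi i = 0 -> is_frame Phi ->
  forall i j, dotmx (canonical_dual Phi i) (Phi j) =
    (i == j)%:R - (d.+1%:R^-1)%:C.
Proof.
move=> Phi0 fPhi; have hPhi := canonical_dual_herm fPhi.
have [b b1 Pb] := dual_frame_gram Phi0 (canonical_dual_is_dual fPhi).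
(* Hermitian symmetry of the cross Gramian; at [i = j] it makes each [b j] real, hence all of them
   are equal. *)
have bij i j : b j = (b i)^*.
  have /matrixP/(_ i j) := hPhi; rewrite mxE mxE !frame_mx_adj !Pb.
  by rewrite rmorphB rmorph_nat eq_sym => /addrI/oppr_inj.
have bE j : b j = (d.+1%:R^-1)%:C.
  have bj i : b i = b j by rewrite (bij j i) -(bij j j).
  move: b1; under eq_bigr => i _ do rewrite bj.
  rewrite sumr_const card_ord => b1.
  rewrite fmorphV rmorph_nat.
  apply: (@mulIf _ d.+1%:R); first by rewrite pnatr_eq0.
  by rewrite mulr_natr b1 mulVf // pnatr_eq0.
by move=> i j; rewrite Pb bE.
Qed.

(** Analysis by [Phi] is injective, since synthesis by [Psi] inverts it. *)
Lemma dual_frame_gram_inj Phi Psi Psi' :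
  is_dual_frame Phi Psi ->
  (forall i j, dotmx (Psi i) (Phi j) = dotmx (Psi' i) (Phi j)) -> Psi = Psi'.
Proof.
move=> /is_dual_frameP PhiPsi eqg; apply/funext => i; apply/eqP.
have : (Psi i - Psi' i) *m (frame_mx Phi)^t* = 0.
  apply/rowP => j; rewrite mul_frame_mx_adj linearBl /= eqg mxE.
  exact: subrr.
move/(congr1 (mulmx^~ (frame_mx Psi))) => /=.
by rewrite -mulmxA PhiPsi mulmx1 mul0mx => /eqP; rewrite subr_eq0.
Qed.

(** The trace [d] is written as [d + 1] copies of its average, the form that averaging and its
    equality case use. *)
Lemma sum_dual_diag Phi Psi : \sum_i Phi i = 0 -> is_dual_frame Phi Psi ->
  \sum_i dotmx (Psi i) (Phi i) = (1 - d.+1%:R^-1)%:C *+ #|'I_d.+1|.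
Proof.
move=> Phi0 /(dual_frame_gram Phi0) [b b1 Pb].
under eq_bigr => i _ do rewrite Pb eqxx.
rewrite sumrB b1 sumr_const card_ord rmorphB fmorphV rmorph_nat /= mulrnBl.
by congr (_ - _); rewrite -[RHS]mulr_natr mulVf // pnatr_eq0.
Qed.

Lemma le_rho1_dual Phi Psi : \sum_i Phi i = 0 -> is_dual_frame Phi Psi ->
  1 - d.+1%:R^-1 <= rho Phi Psi 1.
Proof.
move=> Phi0 /(sum_dual_diag Phi0) PsiE.
have c0 : 0 <= 1 - d.+1%:R^-1 :> R by rewrite subr_ge0 invf_le1 ?ler1n.
have : `|\sum_i dotmx (Psi i) (Phi i)| <= (rho Phi Psi 1)%:C *+ #|'I_d.+1|.
  rewrite -sumr_const; apply: le_trans (ler_norm_sum _ _ _) _.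
  by apply: ler_sum => i _; rewrite -normc_le le_rho1.
by rewrite PsiE ger0_norm ?mulrn_wge0 ?ler0c // lerMn2r card_ord lecR.
Qed.

Lemma rho1_canonical Phi : \sum_i Phi i = 0 -> is_frame Phi ->
  rho Phi (canonical_dual Phi) 1 = 1 - d.+1%:R^-1.
Proof.
move=> Phi0 fPhi; apply/le_anti/andP; split; last first.
  exact: le_rho1_dual (canonical_dual_is_dual fPhi).
have c0 : 0 <= 1 - d.+1%:R^-1 :> R by rewrite subr_ge0 invf_le1 ?ler1n.
apply: rho1_le => // i; rewrite canonical_dual_gram // eqxx.
by rewrite -(rmorph1 (real_complex R)) -rmorphB normc_real ger0_norm.
Qed.

(** Equality in the averaging bound fixes every diagonal entry [1 - b j], hence [b], the cross
    Gramian and finally [Psi]. *)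
Lemma rho1_canonical_unique Phi Psi : \sum_i Phi i = 0 -> is_frame Phi ->
  is_dual_frame Phi Psi -> rho Phi Psi 1 <= 1 - d.+1%:R^-1 ->
  Psi = canonical_dual Phi.
Proof.
move=> Phi0 fPhi dPsi rPsi; have [b _ Pb] := dual_frame_gram Phi0 dPsi.
apply: (dual_frame_gram_inj dPsi) => i j.
have := sum_maximal_modulus _ (sum_dual_diag Phi0 dPsi) j.
rewrite canonical_dual_gram // !Pb eqxx => bj.
congr (_ - _); apply/oppr_inj/(addrI 1).
rewrite -(rmorph1 (real_complex R)) -rmorphB.
by apply: bj => k; rewrite -normc_le (le_trans (le_rho1 _ _ _)).
Qed.

Lemma rho2_canonical Phi : (0 < d)%N -> \sum_i Phi i = 0 -> is_frame Phi ->
  rho Phi (canonical_dual Phi) 2 = 1.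
Proof.
move=> d0 Phi0 fPhi; have gramE := canonical_dual_gram Phi0 fPhi.
apply/le_anti/andP; split; last exact: rho2_ge1 gramE.
by apply: rho2_le1 gramE; rewrite invr_ge0 ler0n invf_le1 ?ler1n.
Qed.

End SimplexFrames.

(** * Graph frames *)

Lemma sum_graph_frame (R : realType) (d n : nat) (e : rel 'I_n)
  (Phi : 'I_n -> 'rV[R[i]]_d) : is_graph_frame e Phi -> \sum_i Phi i = 0.
Proof.
move=> [_ gramE]; apply/eqP; rewrite -(dnorm_eq0 (dotmx (n:=d))); apply/eqP.
(* The squared norm of the sum is the sum of all Gramian entries, and each row of the Laplacian sums
   to zero. *)
rewrite linear_sumr /= big1 // => i _; rewrite linear_sumlz /=.
under eq_bigr => j _.
  have /matrixP/(_ i j) := gramE; rewrite mxE => ->.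
  rewrite !mxE.
  over.
rewrite sumrB (bigD1 i) //= eqxx mulr1n big1 => [|j /negPf]; last first.
  by rewrite eq_sym => ->.
by rewrite addr0 -natr_sum -sum1_card big_mkcond subrr.
Qed.

Theorem corollary4p1 (R : realType) (n : nat) (hn : (3 <= n)%N)
    (e : rel 'I_n) (e_sym : symmetric e) (e_irr : irreflexive e)
    (e_conn : forall x y : 'I_n, connect e x y)
    (Phi : 'I_n -> 'rV[R[i]]_(n.-1)) (hPhi : is_graph_frame e Phi) :
  [/\ spectrally_optimal2 Phi (canonical_dual Phi),
      forall Psi : 'I_n -> 'rV[R[i]]_(n.-1),
        spectrally_optimal2 Phi Psi -> Psi = canonical_dual Phi
    & is_min_rho Phi 2 1].
Proof.
case: n => [//|d] /= in hn e e_sym e_irr e_conn Phi hPhi *.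
have Phi0 := sum_graph_frame hPhi; have [fPhi _] := hPhi.
have dPhi := canonical_dual_is_dual fPhi.
have d0 : (0 < d)%N by exact: ltnW.
have min2 : is_min_rho Phi 2 1.
  split=> [|_ [Psi /= dPsi <-]].
    by exists (canonical_dual Phi) => //; exact: rho2_canonical.
  by have [b _ Pb] := dual_frame_gram Phi0 dPsi; exact: rho2_ge1 Pb.
split=> //; last first.
  (* Uniqueness comes from 1-erasure optimality, by comparison with the canonical dual. *)
  move=> Psi [[dPsi [_ minPsi]] _]; apply: rho1_canonical_unique => //.
  rewrite -(rho1_canonical Phi0 fPhi).
  by apply: minPsi; exists (canonical_dual Phi).
split; last by rewrite rho2_canonical.
split=> //; split=> [|_ [Psi /= dPsi <-]]; first by exists (canonical_dual Phi).
by rewrite rho1_canonical //; exact: le_rho1_dual.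
Qed.
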